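(* Let $K=B_2^4\times B_2^4\subset\mathbb{R}^4\oplus\mathbb{R}^4=\mathbb{R}^8$, where $B_2^4$ is the Euclidean unit ball of $\mathbb{R}^4$, let $\alpha=1+\frac1{\sqrt5}$, and let $Q\in\mathrm{SO}(8)$ be the rotation and $E_8\subset\mathbb{R}^8$ the lattice described in the context. Then the center lattice $(2/\sqrt{\alpha})\,QE_8$ gives a lattice packing of $B_2^4\times B_2^4$ of density $$\delta_K(QE_8)=\frac{\pi^4}{1024}\left(1+\frac1{\sqrt5}\right)^4=0.417282401491719\ldots .$$
   Context: The lattice $E_8$ is $$E_8=\Big\{x\in\mathbb{Z}^8:\sum_i x_i\equiv0\!\!\pmod 2\Big\}\cup\Big\{x\in(\mathbb{Z}+\tfrac12)^8:\sum_i x_i\equiv0\!\!\pmod 2\Big\}.$$ Let $$H=\begin{pmatrix} -1&0&0&1&0&1&-1&-1\\ 0&-1&0&-1&0&-1&-1&-1\\ 0&0&-1&1&0&-1&-1&1\\ 1&-1&1&1&1&0&0&0\\ 0&0&0&1&-1&-1&1&-1\\ 1&-1&-1&0&-1&1&0&0\\ -1&-1&-1&0&1&0&1&0\\ -1&-1&1&0&-1&0&0&1 \end{pmatrix},$$ a symmetric integer matrix with $H^2=5I$ and $\operatorname{tr}H=0$. Its $+\sqrt5$ eigenspace $U$ and $-\sqrt5$ eigenspace $V=U^\perp$ are orthogonal $4$-dimensional subspaces of $\mathbb{R}^8$. $Q\in\mathrm{SO}(8)$ is a chosen rotation with $Q(U)=\mathbb{R}^4\oplus\{0\}$ and $Q(V)=\{0\}\oplus\mathbb{R}^4$.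 For a centrally symmetric convex body $K\subset\mathbb{R}^n$ with Minkowski norm $\|\cdot\|_K$ and a lattice $\Lambda\subset\mathbb{R}^n$, put $m_K(\Lambda)=\min_{0\ne x\in\Lambda}\|x\|_K$ and $$\delta_K(\Lambda)=\frac{\operatorname{vol}(K)}{\operatorname{covol}(\Lambda)}\left(\frac{m_K(\Lambda)}{2}\right)^n,$$ where $\operatorname{vol}$ is Euclidean volume and $\operatorname{covol}$ is covolume; this is the density of the lattice packing of unit copies of $K$ with center lattice $(2/m_K(\Lambda))\Lambda$. A lattice packing of $K$ with center lattice $\Lambda'$ means that the translates $K+\lambda$, $\lambda\in\Lambda'$, have pairwise disjoint interiors, and its density is $\operatorname{vol}(K)/\operatorname{covol}(\Lambda')$. For $K=B_2^4\times B_2^4$ the norm is $\|(x,y)\|_K=\max\{\|x\|_2,\|y\|_2\}$, $x,y\in\mathbb{R}^4$. *)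

(* Defs.v *)
From HB Require Import structures.
From mathcomp Require Import all_boot all_order all_algebra.
From mathcomp Require Import all_classical all_reals all_analysis.
Import Order.TTheory GRing.Theory Num.Theory.
Import numFieldNormedType.Exports.

Set Implicit Arguments.
Unset Strict Implicit.
Unset Printing Implicit Defensive.

Local Open Scope classical_set_scope.
Local Open Scope ring_scope.

(* Points of R^n are column vectors. *)

Section Volume.
Variable R : realType.

(* Lebesgue measure on R^n, as the n-fold product measure: the product of
   Lebesgue measure on R with the measure in dimension n-1, transported along
   (x, t) |-> x :: t. *)
Fixpoint lebesgue_tuple (n : nat) : set (n.-tuple (measurableTypeR R)) -> \bar R :=
  match n with
  | 0 => dirac [tuple]
  | n'.+1 => pushforward
      (product_measure1 (@lebesgue_measure R) (@lebesgue_tuple n'))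
      (fun p : measurableTypeR R * n'.-tuple (measurableTypeR R) =>
         cons_tuple p.1 p.2)
  end.

Definition vol (n : nat) (A : set 'cV[R]_n) : R :=
  fine (lebesgue_tuple [set t : n.-tuple R | A (\col_i tnth t i)]).

End Volume.

Section Lattices.
Variables (R : realType) (n : nat).
Implicit Types (K L : set 'cV[R]_n) (B : 'M[R]_n).

(* The columns of B are an integral basis of L, a lattice of full rank. *)
Definition lattice_basis B L : Prop :=
  B \in unitmx /\
  L = [set B *m map_mx intr z | z in [set: 'cV[int]_n]].

Definition is_lattice L : Prop := exists B, lattice_basis B L.

(* |det B| is the same for all integral bases of L; 0 if L is not a lattice. *)
Definition covol L : R :=
  xget 0 [set `|\det B| | B in [set B | lattice_basis B L]].

Definition minkowski_norm K (x : 'cV[R]_n) : R :=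
  inf [set t : R | 0 < t /\ [set t *: y | y in K] x].

(* The attained minimum m_K(L); 0 if there is no minimum. *)
Definition min_norm K L : R :=
  let S := [set minkowski_norm K x | x in L `\ 0] in
  xget 0 (S `&` lbound S).

Definition delta K L : R :=
  vol K / covol L * (min_norm K L / 2) ^+ n.

Definition translate K (v : 'cV[R]_n) : set 'cV[R]_n := [set x + v | x in K].

Definition lattice_packing K L : Prop :=
  is_lattice L /\
  forall u v, L u -> L v -> u != v ->
    (translate K u)° `&` (translate K v)° = set0.

Definition packing_density K L : R := vol K / covol L.

Definition scale_set (r : R) L : set 'cV[R]_n := [set r *: x | x in L].

Definition mx_image B L : set 'cV[R]_n := [set B *m x | x in L].

Definition special_orthogonal B : Prop := B^T *m B = 1%:M /\ \det B = 1.

Definition enorm (x : 'cV[R]_n) : R := Num.sqrt (\sum_i x i 0 ^+ 2).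

Definition euclidean_ball : set 'cV[R]_n := [set x | enorm x <= 1].

Definition mx_eigenspace B (a : R) : set 'cV[R]_n := [set x | B *m x = a *: x].

End Lattices.

Arguments euclidean_ball {R n}.

Section E8.
Variable R : realType.

Definition even_sum (x : 'cV[R]_8) : Prop :=
  exists k : int, \sum_i x i 0 = (2 * k)%:~R.

Definition E8 : set 'cV[R]_8 :=
  [set x : 'cV[R]_8 | (forall i, x i 0 \is a Num.int) /\ even_sum x] `|`
  [set x : 'cV[R]_8 | (forall i, x i 0 - 2^-1 \is a Num.int) /\ even_sum x].

Definition H_rows : seq (seq int) :=
  [:: [:: -1;  0;  0;  1;  0;  1; -1; -1];
      [::  0; -1;  0; -1;  0; -1; -1; -1];
      [::  0;  0; -1;  1;  0; -1; -1;  1];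
      [::  1; -1;  1;  1;  1;  0;  0;  0];
      [::  0;  0;  0;  1; -1; -1;  1; -1];
      [::  1; -1; -1;  0; -1;  1;  0;  0];
      [:: -1; -1; -1;  0;  1;  0;  1;  0];
      [:: -1; -1;  1;  0; -1;  0;  0;  1]].

Definition Hmx : 'M[R]_8 := \matrix_(i, j) (nth 0 (nth [::] H_rows i) j)%:~R.

Definition U : set 'cV[R]_8 := mx_eigenspace Hmx (Num.sqrt 5).
Definition V : set 'cV[R]_8 := mx_eigenspace Hmx (- Num.sqrt 5).

(* R^8 is split as R^4 (+) R^4: first and last four coordinates. *)
Definition fst4 (x : 'cV[R]_8) : 'cV[R]_4 := usubmx (x : 'cV[R]_(4 + 4)).
Definition snd4 (x : 'cV[R]_8) : 'cV[R]_4 := dsubmx (x : 'cV[R]_(4 + 4)).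

Definition R4_left : set 'cV[R]_8 := [set x | snd4 x = 0].
Definition R4_right : set 'cV[R]_8 := [set x | fst4 x = 0].

Definition ball_product : set 'cV[R]_8 :=
  [set x | euclidean_ball (fst4 x) /\ euclidean_ball (snd4 x)].

(* The number 0.d_1 d_2 d_3 with decimal digits s = [:: d_1; d_2; d_3]. *)
Definition decimal (s : seq nat) : R :=
  \sum_(i < size s) (nth 0%N s i)%:R / 10 ^+ i.+1.

(* x = 0.d_1 ... d_k ... : the decimal expansion of x begins with s. *)
Definition decimal_expansion_starts (x : R) (s : seq nat) : Prop :=
  decimal s <= x < decimal s + 10 ^- size s.

End E8.

Arguments E8 {R}.
Arguments Hmx {R}.
Arguments U {R}.
Arguments V {R}.
Arguments R4_left {R}.
Arguments R4_right {R}.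
Arguments ball_product {R}.

(* Main.v *)
Require Import Defs.
From HB Require Import structures.
From mathcomp Require Import all_boot all_order all_algebra.
From mathcomp Require Import all_classical all_reals all_analysis.
From mathcomp Require Import zify ring lra.
Import Order.TTheory GRing.Theory Num.Theory.
Import numFieldNormedType.Exports.
Local Open Scope classical_set_scope.
Local Open Scope ring_scope.

(* The projections of [x] to [U] and [V] have squared norms
   [(x.x +- x.Hx / sqrt 5) / 2], so the squared K-norm of [Q x] is
   [(x.x + |x.Hx| / sqrt 5) / 2]. On E8, [x.x] is even and [x.x + x.Hx] is a
   multiple of 4 (in a lattice basis these forms have Gram matrices
   [T + T^T] and [2 (T + T^T)] with [T] integral and triangular); hence
   [|x.Hx| >= 2] when [x.x = 2], and the minimum is [alpha = 1 + 1 / sqrt 5],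
   attained at [e_1 + e_2]. The volume of the product of balls is an iterated integral
   of powers of [sqrt (r - x ^ 2)]. For the decimals, [alpha ^ 4] is affine in
   [1 / sqrt 5], and pi is bounded by Machin's formula and Taylor polynomials of
   the arctangent. *)

Set Implicit Arguments.
Unset Strict Implicit.
Unset Printing Implicit Defensive.

(** * Volume of the product of two balls *)

(** [product_measure1] is by definition the integral of the measures of slices, so the first
    coordinate can be sliced off any set. *)
Lemma lebesgue_tupleS (R : realType) n (A : set (n.+1.-tuple R)) :
  lebesgue_tuple A =
  (\int[@lebesgue_measure R]_x
     lebesgue_tuple [set t : n.-tuple R | A (cons_tuple x t)])%E.
Proof.
rewrite /= /pushforward /product_measure1; apply: eq_integral => x _ /=.
congr lebesgue_tuple; apply/seteqP; split => t /=.
  by rewrite /xsection /= inE.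
by move=> At; rewrite /xsection /= inE.
Qed.

Lemma lebesgue_tuple0 (R : realType) n : @lebesgue_tuple R n set0 = 0%E.
Proof.
elim: n => [|n IH]; first by rewrite /= dirac0.
by rewrite lebesgue_tupleS integral0_eq.
Qed.

Section Shell.
Variable R : realType.
Notation mu := (@lebesgue_measure R).

(** Measure of a [k]-dimensional ball of squared radius [r], when the unit ball has measure [C]. The
    test matters for [k = 0], where the power is 1 even for negative [r]. *)
Definition radial (C : R) k (r : R) : R :=
  if 0 <= r then C * Num.sqrt r ^+ k else 0.

(* No derivative is required at the endpoints, where the square root is not
   differentiable. *)
Definition semicircle_primitive k (s : R) (F : R -> R) :=
  {within `[- s, s], continuous F} /\
  forall x, - s < x < s -> is_derive x 1 F (Num.sqrt (s ^+ 2 - x ^+ 2) ^+ k).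

Lemma sqr_le_itv (r x : R) : 0 <= r ->
  (0 <= r - x ^+ 2) = (x \in `[- Num.sqrt r, Num.sqrt r]).
Proof.
move=> r0; by rewrite in_itv /= -ler_norml subr_ge0 -sqrtr_sqr ler_sqrt.
Qed.

Lemma continuous_semicircle (r : R) k :
  continuous (fun x : R => Num.sqrt (r - x ^+ 2) ^+ k).
Proof.
move=> x.
apply: (@cvg_comp _ _ _ (fun x : R => Num.sqrt (r - x ^+ 2)) (fun y => y ^+ k)).
  apply: (@cvg_comp _ _ _ (fun x : R => r - x ^+ 2) (@Num.sqrt R)).
    by apply: cvgB; [exact: cvg_cst | exact: exprn_continuous].
  exact: sqrt_continuous.
exact: exprn_continuous.
Qed.

(** [I] is the integral of [(1 - x ^ 2) ^ (k / 2)] over [[-1, 1]]. The integrand vanishes outside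
    [[- sqrt r, sqrt r]]; inside, the fundamental theorem of calculus applies. *)
Lemma integral_radial k (C I : R) (r : R) :
  (forall s : R, 0 < s -> exists2 F, semicircle_primitive k s F &
     F s - F (- s) = I * s ^+ k.+1) ->
  (\int[mu]_x (radial C k (r - x ^+ 2))%:E = (radial (C * I) k.+1 r)%:E)%E.
Proof.
move=> HF; rewrite {2}/radial; case: (leP 0 r) => [r0|r0]; last first.
  rewrite integral0_eq // => x _; rewrite /radial ifF //.
  by apply/negP; rewrite subr_ge0 => /(le_trans (sqr_ge0 x)); rewrite leNgt r0.
set s := Num.sqrt r.
transitivity (\int[mu]_(x in `[(- s)%R, s]) (C * Num.sqrt (r - x ^+ 2) ^+ k)%:E)%E.
  rewrite [RHS]integral_mkcond; apply: eq_integral => x _.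
  rewrite /radial sqr_le_itv // /patch.
  by case: ifPn => xs; [rewrite mem_set | rewrite memNset //; exact/negP].
(* For [r = 0] the interval is a point, and the factor [s ^+ k.+1] makes the right side 0 too. *)
have [s0|s0] := leP s 0.
  have -> : s = 0 by apply/le_anti; rewrite s0 sqrtr_ge0.
  by rewrite oppr0 set_itv1 integral_set1 exprS mul0r mulr0.
have [F [Fc Fd] FI] := HF s s0.
have sE : s ^+ 2 = r by rewrite sqr_sqrtr.
have ss : - s < s by rewrite gtrN.
have CFc : {within `[- s, s], continuous (fun x => C * F x)}.
  by move=> x; apply: cvgM; [exact: cvg_cst|exact: Fc].
have CFd (x : R) : - s < x < s ->
    is_derive x 1 (fun x => C * F x) (C * Num.sqrt (r - x ^+ 2) ^+ k).
  move=> xs; have Fdx := Fd _ xs; rewrite sE in Fdx.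
  exact: is_deriveZ.
rewrite (@continuous_FTC2 _ _ (fun x => C * F x)) //.
- by rewrite -EFinB -mulrBr FI mulrA.
- apply: continuous_subspaceT => x; apply: cvgM; first exact: cvg_cst.
  exact: continuous_semicircle.
- have [_ H1 H2] := (continuous_within_itvP _ ss).1 CFc; split => // x.
  rewrite in_itv /= => xs; exact: (@ex_derive _ _ _ _ _ _ _ (CFd _ xs)).
- move=> x; rewrite in_itv /= => xs.
  by rewrite derive1E; have := CFd _ xs => H; rewrite derive_val.
Qed.

Lemma semicircle_primitive0 (s : R) : 0 < s ->
  exists2 F, semicircle_primitive 0 s F & F s - F (- s) = 2 * s ^+ 1.
Proof.
move=> s0; exists id; last by rewrite expr1; ring.
split; first by apply: continuous_subspaceT => x; exact: cvg_id.
by move=> x _; rewrite expr0; exact: is_derive_id.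
Qed.

Lemma semicircle_primitive2 (s : R) : 0 < s ->
  exists2 F, semicircle_primitive 2 s F & F s - F (- s) = 4 / 3 * s ^+ 3.
Proof.
move=> s0; exists (fun x => s ^+ 2 * x - 3^-1 * x ^+ 3); last by field.
have Fd (x : R) : is_derive x 1 (fun x => s ^+ 2 * x - 3^-1 * x ^+ 3)
    (s ^+ 2 - x ^+ 2).
  apply: is_derive_eq; rewrite /GRing.scale /=; by field.
split.
  apply: derivable_within_continuous => x _; exact: ex_derive.
move=> x /andP[x1 x2]; rewrite sqr_sqrtr //; nra.
Qed.

(** Continuity up to the endpoints, where [asin] has no derivative, comes from inverting the sine on
    a closed interval. *)
Lemma continuous_within_asin : {within `[-1, 1], continuous (@asin R)}.
Proof.
have p0 := @pi_gt0 R.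
have := @segment_can_le_continuous R (- (pi / 2)) (pi / 2) sin asin.
rewrite sinN sin_pihalf; apply; first by lra.
  by apply: continuous_subspaceT; exact: continuous_sin.
exact: sinK.
Qed.

Lemma is_derive_semicircle (s x : R) : - s < x < s ->
  is_derive x 1 (fun x : R => Num.sqrt (s ^+ 2 - x ^+ 2))
    (- x / Num.sqrt (s ^+ 2 - x ^+ 2)).
Proof.
move=> /andP[x1 x2].
have y0 : 0 < s ^+ 2 - x ^+ 2 by nra.
have H := is_derive1_sqrt y0.
have H2 : is_derive x 1 (fun x : R => s ^+ 2 - x ^+ 2) (- (2 * x)).
  by apply: is_derive_eq; rewrite /GRing.scale /=; ring.
have H3 := @is_derive1_comp _ _ (fun x => _) x _ _ H H2; rewrite /comp /= in H3.
apply: is_derive_eq; rewrite /GRing.scale /= ; field.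
by rewrite sqrtr_eq0 -ltNge.
Qed.

Lemma is_derive_asin_scale (s x : R) : - s < x < s ->
  is_derive x 1 (fun x : R => asin (x / s)) (Num.sqrt (s ^+ 2 - x ^+ 2))^-1.
Proof.
move=> /andP[x1 x2].
have s0 : 0 < s by lra.
have xs : -1 < x / s < 1 by rewrite ltr_pdivrMr // ltr_pdivlMr //; apply/andP; split; lra.
have H := is_derive1_asin xs.
have H2 : is_derive x 1 (fun x : R => x / s) s^-1.
  by apply: is_derive_eq; rewrite /GRing.scale /=; ring.
have H3 := @is_derive1_comp _ _ (fun x => _) x _ _ H H2; rewrite /comp /= in H3.
apply: is_derive_eq; rewrite /GRing.scale /=.
have -> : s ^+ 2 - x ^+ 2 = s ^+ 2 * (1 - (x / s) ^+ 2) by field; rewrite gt_eqF.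
by rewrite sqrtrM ?sqr_ge0 // sqrtr_sqr gtr0_norm // invfM mulrC.
Qed.

Lemma continuous_within_asin_scale (s : R) : 0 < s ->
  {within `[- s, s], continuous (fun x : R => asin (x / s))}.
Proof.
move=> s0.
apply/subspace_continuousP => x xs.
have k1 (y : R) : `[- s, s]%classic y -> `[-1, 1]%classic (y / s).
  rewrite /= !in_itv /= => /andP[? ?].
  by rewrite ler_pdivrMr // ler_pdivlMr // mulN1r mul1r; apply/andP.
have := (subspace_continuousP _ _).1 continuous_within_asin _ (k1 _ xs).
apply: cvg_trans; apply: (@cvg_comp _ _ _ (fun y => y / s)) => //.
move=> P /= wP.
have kc : (fun y : R => y / s) @ x --> x / s by apply: cvgM; [exact: cvg_id|exact: cvg_cst].
have /= := kc _ wP; rewrite /within /=.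
by apply: (@filterS _ (nbhs x)) => y Py /k1.
Qed.

Lemma semicircle_primitive1 (s : R) : 0 < s ->
  semicircle_primitive 1 s (fun x =>
    2^-1 * (x * Num.sqrt (s ^+ 2 - x ^+ 2) + s ^+ 2 * asin (x / s))).
Proof.
move=> s0; split.
  move=> x; apply: cvgM; first exact: cvg_cst.
  apply: cvgD; last first.
    by apply: cvgM; [exact: cvg_cst|exact: continuous_within_asin_scale].
  apply: (@continuous_subspaceT _ _ _ (fun x : R => x * Num.sqrt (s ^+ 2 - x ^+ 2))).
  by move=> y; apply: cvgM; [exact: cvg_id|exact: (@continuous_semicircle (s ^+ 2) 1)].
move=> x xs; have H1 := is_derive_semicircle xs; have H2 := is_derive_asin_scale xs.
have xs' := xs; move/andP: xs' => [x1 x2].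
have y0 : 0 < s ^+ 2 - x ^+ 2 by nra.
apply: is_derive_eq; rewrite /GRing.scale /= expr1.
set w := Num.sqrt _.
have w0 : w != 0 by rewrite sqrtr_eq0 -ltNge.
(* Eliminating [s] leaves a rational identity in [w] and [x]. *)
have ws : s ^+ 2 = w ^+ 2 + x ^+ 2 by rewrite sqr_sqrtr ?ltW //; ring.
by rewrite ws; field.
Qed.

(** Integration by parts reduces the third power to the first, whose primitive enters with the
    factor [3 * s ^+ 2]. *)
Lemma semicircle_primitive3 (s : R) : 0 < s ->
  semicircle_primitive 3 s (fun x =>
    4^-1 * (x * Num.sqrt (s ^+ 2 - x ^+ 2) ^+ 3 +
     3 * s ^+ 2 * (2^-1 * (x * Num.sqrt (s ^+ 2 - x ^+ 2) + s ^+ 2 * asin (x / s))))).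
Proof.
move=> s0; have [c1 d1] := semicircle_primitive1 s0; split.
  move=> x; apply: cvgM; first exact: cvg_cst.
  apply: cvgD; last first.
    by apply: cvgM; [exact: cvg_cst|exact: c1].
  apply: (@continuous_subspaceT _ _ _ (fun x : R => x * Num.sqrt (s ^+ 2 - x ^+ 2) ^+ 3)).
  by move=> y; apply: cvgM; [exact: cvg_id|exact: continuous_semicircle].
move=> x xs; have H1 := is_derive_semicircle xs; have H2 := d1 _ xs.
have xs' := xs; move/andP: xs' => [x1 x2].
have y0 : 0 < s ^+ 2 - x ^+ 2 by nra.
apply: is_derive_eq; rewrite /GRing.scale /= ?expr1.
set w := Num.sqrt _.
have w0 : w != 0 by rewrite sqrtr_eq0 -ltNge.
have ws : s ^+ 2 = w ^+ 2 + x ^+ 2 by rewrite sqr_sqrtr ?ltW //; ring.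
by rewrite ws; field.
Qed.

Lemma asin1 : asin 1 = pi / 2 :> R.
Proof.
by rewrite -[in LHS]sin_pihalf sinK // in_itv /= lexx andbT; have := @pi_gt0 R; lra.
Qed.

Lemma asinN1 : asin (- 1) = - (pi / 2) :> R.
Proof.
by rewrite -[in LHS]sin_pihalf -sinN sinK // in_itv /= lexx /=; have := @pi_gt0 R; lra.
Qed.

(* Radial condition with one more leading coordinate [x]: slicing at [x] lowers
   the squared radius [r] to [r - x ^ 2]. *)
Definition shell n (A : R -> set (n.-tuple R)) (r : R) : set (n.+1.-tuple R) :=
  [set t | A (r - thead t ^+ 2) (behead_tuple t)].

Lemma lebesgue_tuple_shell n k (C I : R) (A : R -> set (n.-tuple R)) :
  (forall s : R, 0 < s -> exists2 F, semicircle_primitive k s F &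
     F s - F (- s) = I * s ^+ k.+1) ->
  (forall r, lebesgue_tuple (A r) = (radial C k r)%:E) ->
  forall r, lebesgue_tuple (shell A r) = (radial (C * I) k.+1 r)%:E.
Proof.
move=> HF HA r; rewrite lebesgue_tupleS -integral_radial //.
apply: eq_integral => x _; rewrite -HA; congr lebesgue_tuple.
apply/funext => t; rewrite /shell /= theadE; congr (A _ _); exact: val_inj.
Qed.

Lemma lebesgue_tuple_shell4 n (C : R) (A : R -> set (n.-tuple R)) :
  (forall r, lebesgue_tuple (A r) = (radial C 0 r)%:E) ->
  forall r, lebesgue_tuple (shell (shell (shell (shell A))) r) =
    (radial (C * (pi ^+ 2 / 2)) 4 r)%:E.
Proof.
move=> HA r.
(* The factors are the integrals of [(1 - x ^ 2) ^ (k / 2)] over [[-1, 1]] for [k = 0, 1, 2, 3];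
   their product is the volume of the unit 4-ball. *)
have -> : C * (pi ^+ 2 / 2) = C * 2 * (pi / 2) * (4 / 3) * (3 / 8 * pi) :> R by field.
apply: lebesgue_tuple_shell; last apply: lebesgue_tuple_shell;
  last apply: lebesgue_tuple_shell; last apply: lebesgue_tuple_shell; last exact: HA.
- move=> s s0; exists (fun x =>
    4^-1 * (x * Num.sqrt (s ^+ 2 - x ^+ 2) ^+ 3 +
     3 * s ^+ 2 * (2^-1 * (x * Num.sqrt (s ^+ 2 - x ^+ 2) + s ^+ 2 * asin (x / s))))).
    exact: semicircle_primitive3.
  (* At [s] and [- s] the square root vanishes, so only the arcsine contributes. *)
  rewrite sqrrN subrr sqrtr0 !mulNr divff ?gt_eqF // asinN1 asin1; by field.
- exact: semicircle_primitive2.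
- move=> s s0; exists (fun x =>
    2^-1 * (x * Num.sqrt (s ^+ 2 - x ^+ 2) + s ^+ 2 * asin (x / s))).
    exact: semicircle_primitive1.
  rewrite sqrrN subrr sqrtr0 !mulNr divff ?gt_eqF // asinN1 asin1; by field.
- exact: semicircle_primitive0.
Qed.

Lemma vol_ball_product : vol (@ball_product R) = pi ^+ 4 / 4.
Proof.
(* The recursion ends by asking that the squared radius left over be nonnegative. [A4] asks this of
   the first four coordinates and restarts at radius 1 for the last four, so the product of balls is
   four shells over [A4]. *)
pose A0 (r : R) := [set t : 0.-tuple R | 0 <= r].
pose A4 := fun r : R => [set t : 4.-tuple R | 0 <= r /\ shell (shell (shell (shell A0))) 1 t].
have H0 r : lebesgue_tuple (A0 r) = (radial 1 0 r)%:E.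
  rewrite /= diracE /radial /A0 expr0 mulr1; case: ifP => r0.
    by rewrite mem_set.
  by rewrite memNset //= r0.
have H4 r : lebesgue_tuple (A4 r) = (radial (pi ^+ 2 / 2) 0 r)%:E.
  rewrite /radial /A4; case: ifP => r0; last first.
    by rewrite (_ : [set t | _] = set0) ?lebesgue_tuple0 //; apply/seteqP; split => t // [].
  rewrite expr0 mulr1.
  have := lebesgue_tuple_shell4 H0 1; rewrite /radial ler01 sqrtr1 expr1n mulr1 mul1r => <-.
  congr lebesgue_tuple; apply/funext => t /=; apply/propext; split => [[] //|//].
have := lebesgue_tuple_shell4 H4 1; rewrite /radial ler01 sqrtr1 expr1n mulr1 => H8.
rewrite /vol.
rewrite (_ : [set t | _] = shell (shell (shell (shell A4))) 1) ?H8 /=; first by field.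
have sqrt_le1 (a : R) : (Num.sqrt a <= 1) = (a <= 1) by rewrite -{1}sqrtr1 ler_sqrt.
apply/funext => t; apply/propext; do 8 case/tupleP: t => ? t.
rewrite /shell /A4 /A0 /ball_product /euclidean_ball /enorm /= /fst4 /snd4.
rewrite !big_ord_recl !big_ord0 !mxE /thead !(tnth_nth 0) /= !addr0.
by rewrite !sqrt_le1 /shell /= /thead !(tnth_nth 0) /=; split=> -[? ?]; split; lra.
Qed.

End Shell.

(** * Decimal bounds *)

Section PiBounds.
Variable R : realType.

Definition atan_taylor n (x : R) : R :=
  \sum_(k < n) (- 1) ^+ k * x ^+ k.*2.+1 / k.*2.+1%:R.

(** The termwise derivative is a finite geometric sum of ratio [- x ^+ 2]. *)
Lemma is_derive_atan_taylor n (x : R) :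
  is_derive x 1 (atan_taylor n) ((1 - (- x ^+ 2) ^+ n) / (1 + x ^+ 2)).
Proof.
have x1 : 1 + x ^+ 2 != 0 by rewrite gt_eqF // ltr_pwDl // sqr_ge0.
elim: n => [|n IH].
  have -> : atan_taylor 0 = cst 0 by apply/funext => y; rewrite /atan_taylor big_ord0.
  by rewrite expr0 subrr mul0r; exact: is_derive_cst.
have -> : atan_taylor n.+1 = atan_taylor n + (fun x => (- 1) ^+ n / n.*2.+1%:R * x ^+ n.*2.+1).
  by apply/funext => y; rewrite /atan_taylor big_ord_recr /= mulrAC.
set c : R := _ / _.
have H2 m : is_derive x 1 (fun x => c * x ^+ m.+1) (c * (m.+1%:R * x ^+ m)).
  have -> : (fun x => c * x ^+ m.+1) = c \*: ((id : R -> R) ^+ m.+1).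
    by apply/funext => y /=; rewrite exprfctE.
  apply: (is_derive_eq (is_deriveZ c (is_deriveX m.+1 (is_derive_id x 1)))).
  by rewrite /GRing.scale /= mulr1.
have H := H2 n.*2; apply: is_derive_eq.
rewrite /c mulrA mulfVK ?pnatr_eq0 // -mul2n exprM -exprMn mulN1r (exprS _ n).
by field.
Qed.

(** The signed error vanishes at 0 and has derivative [x ^ (2 n) / (1 + x ^ 2)]. Even [n] thus gives
    lower bounds of the arctangent, odd [n] upper bounds. *)
Lemma atan_taylor_sign n (x : R) : 0 <= x -> 0 <= (- 1) ^+ n * (atan x - atan_taylor n x).
Proof.
move=> x0.
pose f : R -> R := fun x => (- 1) ^+ n * (atan x - atan_taylor n x).
have fd (y : R) : is_derive y 1 f ((y ^+ 2) ^+ n / (1 + y ^+ 2)).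
  have H1 := is_derive_atan_taylor n y; have H2 := is_derive1_atan y.
  have y1 : 1 + y ^+ 2 != 0 by rewrite gt_eqF // ltr_pwDl // sqr_ge0.
  apply: is_derive_eq; rewrite /GRing.scale /=.
  rewrite -{1}[_^-1]mul1r -mulrBl opprB addrCA subrr addr0 mulrA -exprMn mulN1r opprK //.
have f0 : f 0 = 0.
  rewrite /f atan0 /atan_taylor big1 ?subrr ?mulr0 // => k _.
  by rewrite expr0n /= mulr0 mul0r.
change (0 <= f x); rewrite -f0.
apply: (@ger0_derive1_le_cc _ f 0 x) => //; rewrite ?in_itv /= ?lexx ?x0 //.
- move=> y _; rewrite derive1E (@derive_val _ _ _ _ _ _ _ (fd y)).
  by apply: divr_ge0; [rewrite exprn_ge0 // sqr_ge0 | rewrite addr_ge0 ?sqr_ge0].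
- by apply: derivable_within_continuous => y _; exact: (@ex_derive _ _ _ _ _ _ _ (fd y)).
Qed.

Lemma atanD (x y : R) : - (pi / 2) < atan x + atan y < pi / 2 ->
  atan x + atan y = atan ((x + y) / (1 - x * y)).
Proof.
move=> xy.
have cos_neq0 (z : R) : cos (atan z) != 0.
  by rewrite gt_eqF // cos_gt0_pihalf // atan_gtNpi2 atan_ltpi2.
have tanE : tan (atan x + atan y) = (x + y) / (1 - x * y) by rewrite tanD ?cos_neq0 // !atanK.
by rewrite -tanE tanK // in_itv.
Qed.

(** Doubling [atan 5^-1] twice gives [atan (5 / 12)] and [atan (120 / 119)]; subtracting
    [atan 239^-1] gives [atan 1]. The bounds by [pi / 4] keep each sum in the range of [atanD]. *)
Lemma machin : pi = 16 * atan 5^-1 - 4 * atan 239^-1 :> R.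
Proof.
have atan_lt1 (x : R) : x < 1 -> atan x < pi / 4 by rewrite -atan1; exact: lt_atan.
have atan_gt0 (x : R) : 0 < x -> 0 < atan x by rewrite -{2}(@atan0 R); exact: lt_atan.
have p0 := @pi_gt0 R.
set a := atan 5^-1; set b := atan 239^-1.
have a0 : 0 < a by apply: atan_gt0; lra.
have a1 : a < pi / 4 by apply: atan_lt1; lra.
have b0 : 0 < b by apply: atan_gt0; lra.
have b1 : b < pi / 4 by apply: atan_lt1; lra.
have a2 : a + a = atan (5 / 12).
  rewrite /a atanD; first by congr atan; field.
  by rewrite -/a; apply/andP; split; lra.
have a2' : a + a < pi / 4 by rewrite a2; apply: atan_lt1; lra.
have a4 : a + a + (a + a) = atan (120 / 119).
  rewrite a2 atanD; first by congr atan; field.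
  by rewrite -a2; apply/andP; split; lra.
have : a + a + (a + a) - b = pi / 4.
  rewrite a4 -atan1 /b -atanN atanD; first by congr atan; field.
  by rewrite atanN -a4 -/b; apply/andP; split; lra.
lra.
Qed.

(* Base 1000 expansion: [digits [:: a; b; c] = a + b / 10^3 + c / 10^6]; keeps every
   numeral small, as they are unary naturals. *)
Definition digits (s : seq nat) : R := foldr (fun d x => d%:R + x / 1000) 0 s.

Lemma pi_bounds :
  digits [:: 3; 141; 592; 653; 589; 793; 238]%N <= pi :> R /\
  pi <= digits [:: 3; 141; 592; 653; 589; 793; 239]%N :> R.
Proof.
have h5 : 0 <= 5^-1 :> R by rewrite invr_ge0.
have h239 : 0 <= 239^-1 :> R by rewrite invr_ge0 ler0n.
(* With these numbers of terms the error on pi is below [10 ^ -19], less than its distance to either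
   18-decimal bound. *)
have := atan_taylor_sign 14 h5; have := atan_taylor_sign 13 h5.
have := atan_taylor_sign 4 h239; have := atan_taylor_sign 5 h239.
rewrite machin /atan_taylor !big_ord_recr !big_ord0 /digits /= !doubleS double0.
set a := atan 5^-1; set b := atan 239^-1.
move=> H1 H2 H3 H4; split; lra.
Qed.

Lemma density_decimal :
  decimal_expansion_starts (pi ^+ 4 / 1024 * (1 + 1 / Num.sqrt 5) ^+ 4 : R)
        [:: 4; 1; 7; 2; 8; 2; 4; 0; 1; 4; 9; 1; 7; 1; 9]%N.
Proof.
have [p1 p2] := pi_bounds.
set s : R := 1 / Num.sqrt 5.
have s0 : 0 < s by rewrite divr_gt0 // sqrtr_gt0.
have s2 : s ^+ 2 = 5^-1 by rewrite /s div1r exprVn sqr_sqrtr.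
have -> : (1 + s) ^+ 4 = 56 / 25 + 24 / 5 * s.
  have -> : (1 + s) ^+ 4 = 1 + 4 * s + 6 * s ^+ 2 + 4 * s * s ^+ 2 + s ^+ 2 * s ^+ 2 by ring.
  by rewrite s2; field.
(* Decimals of [1 / sqrt 5], checked by comparing squares with [1 / 5]. *)
have sl : digits [:: 0; 447; 213; 595; 499; 957; 939]%N <= s.
  rewrite -(@ler_pXn2r _ 2) // ?nnegrE ?(ltW s0) //; last by rewrite /digits /=; lra.
  by rewrite s2 /digits /=; lra.
have su : s <= digits [:: 0; 447; 213; 595; 499; 957; 940]%N.
  rewrite -(@ler_pXn2r _ 2) // ?nnegrE ?(ltW s0) //; last by rewrite /digits /=; lra.
  by rewrite s2 /digits /=; lra.
set d1 := digits _ in p1; set d2 := digits _ in p2.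
have d1_ge0 : 0 <= d1 by rewrite /d1 /digits /=; lra.
have e1 : d1 ^+ 4 <= pi ^+ 4 by rewrite ler_pXn2r ?nnegrE ?pi_ge0.
have e2 : pi ^+ 4 <= d2 ^+ 4 by rewrite ler_pXn2r ?nnegrE ?pi_ge0 // (le_trans (pi_ge0 _)).
set l1 := digits _ in sl; set l2 := digits _ in su.
have l1_ge0 : 0 <= l1 by rewrite /l1 /digits /=; lra.
have lo : d1 ^+ 4 / 1024 * (56 / 25 + 24 / 5 * l1) <= pi ^+ 4 / 1024 * (56 / 25 + 24 / 5 * s).
  have d14 : 0 <= d1 ^+ 4 by rewrite exprn_ge0.
  by clearbody d1 d2 l1 l2; apply: ler_pM; lra.
have hi : pi ^+ 4 / 1024 * (56 / 25 + 24 / 5 * s) <= d2 ^+ 4 / 1024 * (56 / 25 + 24 / 5 * l2).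
  have p4 : 0 <= pi ^+ 4 :> R by rewrite exprn_ge0 // pi_ge0.
  by clearbody d1 d2 l1 l2; apply: ler_pM; lra.
rewrite /decimal_expansion_starts /decimal /= !big_ord_recr big_ord0 /=.
apply/andP; split.
  by apply: le_trans lo; rewrite /d1 /l1 /digits /=; lra.
by apply: le_lt_trans hi _; rewrite /d2 /l2 /digits /=; lra.
Qed.
End PiBounds.

(** * The lattice E8 and its minimal vectors *)

Section IntegerMatrices.

(** Entries are functions on naturals, and products and equality tests run over [iota], so
    identities between explicit matrices are decided by computation. *)
Definition int_mx n (f : nat -> nat -> int) : 'M[int]_n := \matrix_(i, j) f i j.

Definition int_mul n (f g : nat -> nat -> int) i j : int :=
  foldr (fun k s => f i k * g k j + s) 0 (iota 0 n).

Lemma int_mxM n f g : int_mx n f *m int_mx n g = int_mx n (int_mul n f g).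
Proof.
apply/matrixP => i j; rewrite !mxE /int_mul.
under eq_bigr do rewrite !mxE.
by rewrite -(big_mkord xpredT (fun k => f i k * g k j)) unlock /index_iota subn0.
Qed.

Lemma int_mx_eq n f g :
  all (fun i => all (fun j => f i j == g i j) (iota 0 n)) (iota 0 n) ->
  int_mx n f = int_mx n g.
Proof.
move=> /allP fg; apply/matrixP => i j; rewrite !mxE; apply/eqP.
have mem_ord (k : 'I_n) : (k : nat) \in iota 0 n by rewrite mem_iota /= ltn_ord.
exact: (allP (fg i (mem_ord i)) j (mem_ord j)).
Qed.

(** A 1 by 1 matrix is its own transpose, so [T] and [T^T] define the same quadratic form. *)
Lemma even_quadratic_form n (M T : 'M[int]_n) (c : int) (z : 'cV[int]_n) :
  M = c *: (T + T^T) -> exists a : int, z^T *m M *m z = (2 * c * a)%:M.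
Proof.
move=> ->; exists ((z^T *m T *m z) 0 0).
have tr11 (A : 'M[int]_1) : A^T = A by rewrite [A]mx11_scalar tr_scalar_mx.
have trT : z^T *m T^T *m z = z^T *m T *m z.
  by rewrite -[RHS]tr11 !trmx_mul trmxK mulmxA.
rewrite -scalemxAr -scalemxAl mulmxDr mulmxDl trT [LHS]mx11_scalar.
by congr _%:M; rewrite !mxE; ring.
Qed.

End IntegerMatrices.

Section E8Lattice.

(* Twice a basis of E8 (as columns): [2 e_1], the [e_(k+1) - e_k] for [k < 7], and
   the vector with all entries 1/2. *)
Definition e8_basis2 (i j : nat) : int :=
  nth 0 (nth [::]
  [:: [:: 4; -2;  0;  0;  0;  0;  0;  1];
      [:: 0;  2; -2;  0;  0;  0;  0;  1];
      [:: 0;  0;  2; -2;  0;  0;  0;  1];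
      [:: 0;  0;  0;  2; -2;  0;  0;  1];
      [:: 0;  0;  0;  0;  2; -2;  0;  1];
      [:: 0;  0;  0;  0;  0;  2; -2;  1];
      [:: 0;  0;  0;  0;  0;  0;  2;  1];
      [:: 0;  0;  0;  0;  0;  0;  0;  1]] i) j.

Definition H_entry (i j : nat) : int := nth 0 (nth [::] H_rows i) j.

(** Gram matrix of [f] in the doubled basis, hence four times the one in the basis of E8. *)
Definition e8_form (f : nat -> nat -> int) :=
  int_mul 8 (fun i j => e8_basis2 j i) (int_mul 8 f e8_basis2).

(* Over [c], an upper triangular [T] such that [f = c (T + T^T)] when there is one. *)
Definition half_form (c : int) (f : nat -> nat -> int) (i j : nat) : int :=
  if (i < j)%N then (f i j %/ c)%Z else if i == j then (f i j %/ (2 * c))%Z else 0.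

Definition id_entry (i j : nat) : int := (i == j)%:R.

Lemma e8_form_half (f : nat -> nat -> int) (c : int) :
  all (fun i => all (fun j => e8_form f i j ==
    c * (half_form c (e8_form f) i j + half_form c (e8_form f) j i)) (iota 0 8)) (iota 0 8) ->
  forall z : 'cV[int]_8, exists a : int,
  (int_mx 8 e8_basis2 *m z)^T *m int_mx 8 f *m (int_mx 8 e8_basis2 *m z) = (2 * c * a)%:M.
Proof.
move=> fc z.
have trE : (int_mx 8 e8_basis2)^T = int_mx 8 (fun i j => e8_basis2 j i).
  by apply/matrixP => i j; rewrite !mxE.
have := @even_quadratic_form _ (int_mx 8 (e8_form f)) (int_mx 8 (half_form c (e8_form f))) c z.
case=> [|a aE].
  by rewrite (int_mx_eq fc); apply/matrixP => i j; rewrite !mxE.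
exists a; rewrite -aE /e8_form -!int_mxM -trE trmx_mul !mulmxA //.
Qed.

(** The doubled vectors have four times the norm, so a multiple of 8 here means an even norm on
    E8. *)
Lemma e8_norm_form (z : 'cV[int]_8) : exists a : int,
  (int_mx 8 e8_basis2 *m z)^T *m int_mx 8 id_entry *m (int_mx 8 e8_basis2 *m z) = (2 * 4 * a)%:M.
Proof. by apply: e8_form_half; vm_compute. Qed.

(** [H + I] has eigenvalues [1 + sqrt 5] and [1 - sqrt 5], twice the golden ratio and its conjugate.
    A multiple of 16 here means a multiple of 4 on E8. *)
Lemma e8_golden_form (z : 'cV[int]_8) : exists a : int,
  (int_mx 8 e8_basis2 *m z)^T *m int_mx 8 (fun i j => H_entry i j + id_entry i j)
    *m (int_mx 8 e8_basis2 *m z) = (2 * 8 * a)%:M.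
Proof. by apply: e8_form_half; vm_compute. Qed.

Lemma H_entry_sqr : int_mx 8 H_entry *m int_mx 8 H_entry = 5%:M.
Proof.
rewrite int_mxM (@int_mx_eq _ _ (fun i j => 5 * id_entry i j)) //.
by apply/matrixP => i j; rewrite !mxE /id_entry mulr_natr.
Qed.

Lemma H_entry_sym : (int_mx 8 H_entry)^T = int_mx 8 H_entry.
Proof.
rewrite -[RHS](@int_mx_eq 8 (fun i j => H_entry j i)) //.
by apply/matrixP => i j; rewrite !mxE.
Qed.

Lemma e8_basis2_onto (u : 'cV[int]_8) (e k : int) :
  \sum_i u i 0 + 4 * e = 2 * k ->
  exists z : 'cV[int]_8, int_mx 8 e8_basis2 *m z = \matrix_(i, j) (2 * u i 0 + e).
Proof.
pose v (i : nat) : int := u (inord i) 0.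
have uv (i : 'I_8) : u i 0 = v i by rewrite /v inord_val.
under eq_bigr do rewrite uv.
rewrite !big_ord_recr big_ord0 /= => uk.
(* Back substitution in the triangular system. Only the first coefficient involves a half of the
   coordinate sum, which the parity hypothesis expresses through [k]. *)
exists (\col_i nth 0 [:: k - 4 * v 7%N - 2 * e;
  v 1%N + v 2%N + v 3%N + v 4%N + v 5%N + v 6%N - 6 * v 7%N;
  v 2%N + v 3%N + v 4%N + v 5%N + v 6%N - 5 * v 7%N;
  v 3%N + v 4%N + v 5%N + v 6%N - 4 * v 7%N;
  v 4%N + v 5%N + v 6%N - 3 * v 7%N;
  v 5%N + v 6%N - 2 * v 7%N;
  v 6%N - v 7%N; 2 * v 7%N + e] i).
apply/matrixP => i j; rewrite !mxE !big_ord_recr big_ord0 /= !mxE uv /e8_basis2.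
by case: i => [[|[|[|[|[|[|[|[|i]]]]]]]] //= _]; lra.
Qed.

Lemma e8_basis2_coord (z : 'cV[int]_8) : exists (u : 'cV[int]_8) (k : int),
  int_mx 8 e8_basis2 *m z = \matrix_(i, j) (2 * u i 0 + z ord_max 0) /\
  \sum_i u i 0 + 4 * z ord_max 0 = 2 * k.
Proof.
pose v (i : nat) : int := z (inord i) 0.
have zv (i : 'I_8) : z i 0 = v i by rewrite /v inord_val.
exists (\col_i nth 0 [:: 2 * v 0%N - v 1%N; v 1%N - v 2%N; v 2%N - v 3%N; v 3%N - v 4%N;
  v 4%N - v 5%N; v 5%N - v 6%N; v 6%N; 0] i), (v 0%N + 2 * v 7%N).
rewrite zv /=; split.
  apply/matrixP => i j; rewrite ord1 !mxE; under eq_bigr do rewrite zv mxE.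
  rewrite !big_ord_recr big_ord0 /= /e8_basis2.
  by case: i => [[|[|[|[|[|[|[|[|i]]]]]]]] //= _]; ring.
under eq_bigr do rewrite mxE.
by rewrite !big_ord_recr big_ord0 /=; ring.
Qed.

End E8Lattice.

(** * E8 as a real lattice of determinant 1 *)

Section RealLattice.
Variable R : realType.

Definition e8_basis : 'M[R]_8 := 2^-1 *: map_mx intr (int_mx 8 e8_basis2).

(** The doubled basis is upper triangular with diagonal product [4 * 2 ^ 6 = 2 ^ 8]; [det_trig]
    expects a lower triangular matrix, hence the transposition. *)
Lemma det_e8_basis : \det e8_basis = 1.
Proof.
rewrite detZ det_map_mx -det_tr det_trig.
  rewrite !big_ord_recr big_ord0 !mxE /=; by field.
apply/is_trig_mxP => i j; rewrite !mxE.
by case: i => [[|[|[|[|[|[|[|[|i]]]]]]]] //= _];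
  case: j => [[|[|[|[|[|[|[|[|j]]]]]]]] //= _].
Qed.

(** [e] selects the integral or the half-integral vectors; its eight halves add [4 * e] to the
    sum. *)
Lemma E8_coord (x : 'cV[R]_8) : E8 x <->
  exists (u : 'cV[int]_8) (e k : int), [/\ (e = 0) \/ (e = 1),
    forall i, x i 0 = (u i 0)%:~R + e%:~R / 2 & \sum_i u i 0 + 4 * e = 2 * k].
Proof.
have sumE (u : 'cV[int]_8) (e : int) : (forall i, x i 0 = (u i 0)%:~R + e%:~R / 2) ->
    \sum_i x i 0 = (\sum_i u i 0 + 4 * e)%:~R.
  move=> xu; under eq_bigr do rewrite xu.
  rewrite big_split /= sumr_const card_ord rmorphD rmorph_sum /= rmorphM /= -mulr_natr.
  congr (_ + _); by field.
split.
  have int_coord (c : R) : (forall i, x i 0 - c \is a Num.int) ->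
      exists u : 'cV[int]_8, forall i, x i 0 = (u i 0)%:~R + c.
    move=> xc; exists (\col_i Num.floor (x i 0 - c)) => i.
    by rewrite mxE floorK // subrK.
  case=> -[xi [k xk]].
    have [i|u xu] := @int_coord 0; first by rewrite subr0.
    exists u, 0, k; split; [by left| by move=> i; rewrite mul0r |].
    by apply: (@intr_inj R); rewrite -xk (sumE u 0) // => i; rewrite mul0r.
  have [//|u xu] := @int_coord 2^-1.
  exists u, 1, k; split; [by right| by move=> i; rewrite xu div1r |].
  by apply: (@intr_inj R); rewrite -xk (sumE u 1) // => i; rewrite xu div1r.
case=> u [e [k [e01 xu uk]]].
have ev : even_sum x by exists k; rewrite (sumE _ _ xu) uk.
case: e01 xu => -> xu; [left|right]; split => // i; rewrite xu.
  by rewrite mul0r addr0 intr_int.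
by rewrite div1r addrK intr_int.
Qed.

Lemma e8_lattice_basis : lattice_basis e8_basis E8.
Proof.
split; first by rewrite unitmxE det_e8_basis unitr1.
apply/seteqP; split => x /=.
  move=> /E8_coord [u [e [k [e01 xu uk]]]].
  have [z zE] := e8_basis2_onto uk; exists z => //.
  apply/matrixP => i j; rewrite ord1 xu -scalemxAl -map_mxM zE !mxE rmorphD rmorphM /=.
  by field.
case=> z _ <-; apply/E8_coord; have [u [k [uE uk]]] := e8_basis2_coord z.
set z7 := z ord_max 0 in uE uk.
(* The last coefficient counts halves; its even part moves into the integral vector, leaving [e]
   equal to 0 or 1. *)
pose e := (z7 %% 2)%Z; pose q := (z7 %/ 2)%Z.
have eE : z7 = q * 2 + e by rewrite /q /e -divz_eq.
exists (u + const_mx q), e, k; split.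
- have : (0 <= e < 2) by rewrite modz_ge0 //= ltz_pmod.
  by case: (e) => [[|[|?]]|?] //; [left|right].
- move=> i; rewrite -scalemxAl -map_mxM uE !mxE eE !(rmorphD, rmorphM) /=.
  by field.
rewrite -uk; under eq_bigr do rewrite mxE [const_mx _ _ _]mxE.
by rewrite big_split /= sumr_const card_ord eE; ring.
Qed.

End RealLattice.

(** * Covolume and interior points for general lattices *)

Section GeneralLattices.
Variables (R : realType) (n : nat).
Implicit Types (L : set 'cV[R]_n) (B Q : 'M[R]_n).

(** The columns of [B'] lie in [L], so [B'] is [B] times an integer matrix. *)
Lemma det_change_basis B B' L : lattice_basis B L -> lattice_basis B' L ->
  exists m : int, \det B' = \det B * m%:~R.
Proof.
move=> [_ LB] [_ LB'].
have zP (j : 'I_n) : {z : 'cV[int]_n | col j B' = B *m map_mx intr z}.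
  apply/cid; have : L (col j B').
    rewrite LB'; exists (delta_mx j 0) => //.
    by rewrite map_delta_mx colE.
  by rewrite LB => -[z _ <-]; exists z.
pose M : 'M[int]_n := \matrix_(i, j) (sval (zP j)) i 0.
exists (\det M); rewrite -det_map_mx -det_mulmx; congr determinant.
apply/matrixP => i j; have := svalP (zP j) => /(congr1 (fun v : 'cV[R]_n => v i 0)).
by rewrite !mxE => ->; apply: eq_bigr => k _; rewrite !mxE.
Qed.

(** The change of basis determinants in the two directions are integers with product 1, so the value
    chosen by [xget] is unique. *)
Lemma covolE B L : lattice_basis B L -> covol L = `|\det B|.
Proof.
move=> BL; apply: xget_unique; first by exists B.
move=> _ [B' B'L <-].
have [m mE] := det_change_basis BL B'L; have [m' mE'] := det_change_basis B'L BL.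
have dB : \det B != 0 by rewrite -unitfE -unitmxE; case: BL.
have mm : m * m' = 1.
  apply: (@intr_inj R); apply: (mulfI dB); rewrite mulr1 rmorphM /= mulrA -mE -mE' //.
rewrite mE normrM.
have -> : `|m%:~R| = 1 :> R.
  have : (`|m| * `|m'|)%N = 1%N by rewrite -abszM mm.
  by move/eqP; rewrite muln_eq1 => /andP[/eqP m1 _]; rewrite -intr_norm -abszE m1.
by rewrite mulr1.
Qed.

Lemma lattice_basis_image Q B L : Q \in unitmx -> lattice_basis B L ->
  lattice_basis (Q *m B) (mx_image Q L).
Proof.
move=> uQ [uB ->]; split; first by rewrite unitmx_mul uQ.
apply/seteqP; split => x /=.
  by case=> _ [z _ <-] <-; exists z; rewrite // mulmxA.
by case=> z _ <-; exists (B *m map_mx intr z); [exists z | rewrite mulmxA].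
Qed.

Lemma lattice_basis_scale (r : R) B L : r != 0 -> lattice_basis B L ->
  lattice_basis (r *: B) (scale_set r L).
Proof.
move=> r0 [uB ->]; split; first by rewrite unitmxZ ?unitfE.
apply/seteqP; split => x /=.
  by case=> _ [z _ <-] <-; exists z; rewrite // scalemxAl.
by case=> z _ <-; exists (B *m map_mx intr z); [exists z | rewrite scalemxAl].
Qed.

Lemma lattice_sub B L x y : lattice_basis B L -> L x -> L y -> L (x - y).
Proof.
move=> [_ ->] [z _ <-] [w _ <-]; exists (z - w) => //.
by rewrite map_mxB mulmxBr.
Qed.

(** An interior point stays in the translate when pushed slightly away from [v]. The factor above 1
    later yields strict norm bounds. *)
Lemma interior_translate_stretch (K : set 'cV[R]_n) (v p : 'cV[R]_n) :
  (translate K v)° p -> exists2 t : R, 1 < t & K (t *: (p - v)).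
Proof.
rewrite /interior => /nbhs_ballP[e /= e0 eK].
(* Neighbourhoods are balls of the maximum norm; [N] exceeds every coordinate of [p - v], so a push
   by [e / N] stays inside. *)
pose N := 1 + \sum_i `|(p - v) i 0|.
have N0 : 0 < N by rewrite ltr_pwDl // sumr_ge0.
have dN i : `|(p - v) i 0| < N.
  rewrite /N (bigD1 i) //= addrCA ltrDl ltr_pwDl // sumr_ge0 //.
pose t := e / N.
have t0 : 0 < t by rewrite divr_gt0.
exists (1 + t); first by rewrite ltrDl.
have : translate K v (p + t *: (p - v)).
  apply: eK; split => // i j; rewrite ord1 -ball_normE /= !mxE.
  rewrite opprD addrA subrr add0r normrN normrM gtr0_norm //.
  by rewrite -ltr_pdivlMl // /t invf_div divfK ?gt_eqF //; have := dN i; rewrite !mxE.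
case=> y Ky yE; suff -> : (1 + t) *: (p - v) = y by [].
by rewrite scalerDl scale1r addrAC -yE addrK.
Qed.

End GeneralLattices.

(** * Quadratic forms on E8 and the two halves of a rotated vector *)

Section GoldenSplitting.
Variable R : realType.

Definition sqnorm n (x : 'cV[R]_n) : R := \sum_i x i 0 ^+ 2.

Definition Hform (x : 'cV[R]_8) : R := (x^T *m Hmx *m x) 0 0.

Lemma sqnormE n (x : 'cV[R]_n) : sqnorm x = (x^T *m x) 0 0.
Proof. by rewrite !mxE; apply: eq_bigr => i _; rewrite mxE expr2. Qed.

Lemma sqnorm_ge0 n (x : 'cV[R]_n) : 0 <= sqnorm x.
Proof. by apply: sumr_ge0 => i _; exact: sqr_ge0. Qed.

Lemma sqnorm_gt0 n (x : 'cV[R]_n) : x != 0 -> 0 < sqnorm x.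
Proof.
move=> x0; rewrite lt_def sqnorm_ge0 andbT; apply: contra x0 => /eqP/psumr_eq0P x0.
apply/eqP/matrixP => i j; rewrite ord1 mxE; apply/eqP.
by rewrite -sqrf_eq0 x0 // => k _; exact: sqr_ge0.
Qed.

Lemma sqnormZ n (a : R) (x : 'cV[R]_n) : sqnorm (a *: x) = a ^+ 2 * sqnorm x.
Proof. by rewrite /sqnorm mulr_sumr; apply: eq_bigr => i _; rewrite mxE exprMn. Qed.

(** The parallelogram law without the term of [x + y]. *)
Lemma sqnormB_le n (x y : 'cV[R]_n) : sqnorm (x - y) <= 2 * sqnorm x + 2 * sqnorm y.
Proof.
rewrite /sqnorm !mulr_sumr -big_split /=; apply: ler_sum => i _; rewrite !mxE.
by have := sqr_ge0 (x i 0 + y i 0); nra.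
Qed.

Lemma sqnorm_split (x : 'cV[R]_8) : sqnorm x = sqnorm (fst4 x) + sqnorm (snd4 x).
Proof.
rewrite /sqnorm (@big_split_ord _ _ _ 4 4) /=; congr (_ + _).
  by apply: eq_bigr => i _; rewrite /fst4 mxE.
by apply: eq_bigr => i _; rewrite /snd4 mxE.
Qed.

Lemma fst4D (x y : 'cV[R]_8) : fst4 (x + y) = fst4 x + fst4 y.
Proof. by apply/matrixP => i j; rewrite !mxE. Qed.

Lemma snd4D (x y : 'cV[R]_8) : snd4 (x + y) = snd4 x + snd4 y.
Proof. by apply/matrixP => i j; rewrite !mxE. Qed.

Lemma fst4Z (a : R) (x : 'cV[R]_8) : fst4 (a *: x) = a *: fst4 x.
Proof. by apply/matrixP => i j; rewrite !mxE. Qed.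

Lemma snd4Z (a : R) (x : 'cV[R]_8) : snd4 (a *: x) = a *: snd4 x.
Proof. by apply/matrixP => i j; rewrite !mxE. Qed.

Lemma HmxE : Hmx = map_mx intr (int_mx 8 H_entry) :> 'M[R]_8.
Proof. by apply/matrixP => i j; rewrite !mxE. Qed.

Lemma Hmx_sqr : Hmx *m Hmx = 5%:M :> 'M[R]_8.
Proof. by rewrite HmxE -map_mxM H_entry_sqr map_scalar_mx. Qed.

Lemma Hmx_sym : Hmx^T = Hmx :> 'M[R]_8.
Proof. by rewrite HmxE map_trmx H_entry_sym. Qed.

Lemma E8_forms (x : 'cV[R]_8) : E8 x ->
  exists a b : int, sqnorm x = 2 * a%:~R /\ sqnorm x + Hform x = 4 * b%:~R.
Proof.
have [_ ->] := e8_lattice_basis R; case=> z _ <-.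
have [a aE] := e8_norm_form z; have [b bE] := e8_golden_form z.
have I1 : int_mx 8 id_entry = 1%:M by apply/matrixP => i j; rewrite !mxE.
have HI : int_mx 8 (fun i j => H_entry i j + id_entry i j) = int_mx 8 H_entry + 1%:M.
  by rewrite -I1; apply/matrixP => i j; rewrite !mxE.
rewrite I1 mulmx1 in aE; rewrite HI in bE.
set y := int_mx 8 e8_basis2 *m z in aE bE.
have -> : e8_basis R *m map_mx intr z = 2^-1 *: map_mx intr y.
  by rewrite -scalemxAl -map_mxM.
have aE' : sqnorm (map_mx intr y : 'cV[R]_8) = (2 * 4 * a)%:~R.
  by rewrite sqnormE map_trmx -map_mxM aE !mxE.
have bE' : sqnorm (map_mx intr y : 'cV[R]_8) + Hform (map_mx intr y) = (2 * 8 * b)%:~R.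
  have := congr1 (fun A : 'M[int]_1 => (A 0 0)%:~R : R) bE.
  rewrite mulmxDr mulmxDl mulmx1 mxE rmorphD /= [in RHS]mxE eqxx mulr1n => <-.
  rewrite sqnormE /Hform HmxE map_trmx -!map_mxM addrC; congr (_ + _); by rewrite [LHS]mxE.
exists a, b; split.
  by rewrite sqnormZ aE' !rmorphM /=; field.
have -> : Hform (2^-1 *: map_mx intr y) = 2^-1 ^+ 2 * Hform (map_mx intr y).
  by rewrite /Hform -scalemxAr [(_ *: _)^T]linearZ /= -!scalemxAl scalerA mxE -expr2.
by rewrite sqnormZ -mulrDr bE' !rmorphM /=; field.
Qed.

Lemma E8_form_ge (x : 'cV[R]_8) : E8 x -> x != 0 ->
  1 + 1 / Num.sqrt 5 <= (sqnorm x + `|Hform x| / Num.sqrt 5) / 2.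
Proof.
move=> Ex x0; have [a [b [aE bE]]] := E8_forms Ex.
have s0 : 0 < Num.sqrt 5 :> R by rewrite sqrtr_gt0.
set s := Num.sqrt 5 in s0 *.
have s1 : 1 <= s by rewrite -[1]sqrtr1 ler_sqrt // ler1n.
have is0 : 0 < s^-1 by rewrite invr_gt0.
have is1 : s^-1 <= 1 by rewrite invf_le1.
have a0 : 0 < a by have := sqnorm_gt0 x0; rewrite aE pmulr_rgt0 // ltr0z.
have [a1|a2] : a = 1 \/ 2 <= a by case: (a) a0 => [[|[|k]]|k] // _; [left|right].
  have H2 : 2 <= `|Hform x|.
    (* An integer congruent to 2 modulo 4 has absolute value at least 2. *)
    have -> : Hform x = (4 * b - 2)%:~R.
      by rewrite rmorphB rmorphM /= -bE aE a1; ring.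
    rewrite -intr_norm (_ : 2 = 2%:~R) // ler_int.
    have := ler_norm (4 * b - 2); have := ler_norm (- (4 * b - 2)); rewrite normrN.
    lia.
  rewrite aE a1 div1r; have : 2 * s^-1 <= `|Hform x| * s^-1 by rewrite ler_pM2r.
  lra.
(* From norm 4 on, half the norm is at least 2, which already bounds alpha. *)
have : 2 <= a%:~R :> R by rewrite -(ler_int R) in a2.
have : 0 <= `|Hform x| / s by rewrite divr_ge0 // ltW.
rewrite aE div1r; lra.
Qed.

Section Rotation.
Variable Q : 'M[R]_8.
Hypothesis hQ : special_orthogonal Q.
Hypothesis hU : mx_image Q U = R4_left.
Hypothesis hV : mx_image Q V = R4_right.

Let s : R := Num.sqrt 5.

Lemma sqnorm_rotate (x : 'cV[R]_8) : sqnorm (Q *m x) = sqnorm x.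
Proof. by rewrite !sqnormE trmx_mul mulmxA -(mulmxA x^T) hQ.1 mulmx1. Qed.

(** Since [H ^ 2 = e ^ 2], the matrix [(I + H / e) / 2] projects onto the eigenspace of [e];
    symmetry of [H] gives [sqnorm (H x) = 5 * sqnorm x]. *)
Lemma eigenprojection (e : R) (x : 'cV[R]_8) : e ^+ 2 = 5 ->
  let u := 2^-1 *: (x + e^-1 *: (Hmx *m x)) in
  Hmx *m u = e *: u /\ sqnorm u = (sqnorm x + Hform x / e) / 2.
Proof.
move=> e2 u.
have e0 : e != 0 by apply/eqP => e0; move: e2; rewrite e0 expr0n /= => /eqP; rewrite eq_sym pnatr_eq0.
split.
  rewrite /u -scalemxAr mulmxDr -scalemxAr mulmxA Hmx_sqr mul_scalar_mx -e2.
  by move: (Hmx *m x) => h; apply/matrixP => i j; rewrite !mxE; field.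
rewrite /u sqnormZ.
have -> : sqnorm (x + e^-1 *: (Hmx *m x)) =
    sqnorm x + 2 * e^-1 * Hform x + e^-1 ^+ 2 * sqnorm (Hmx *m x).
  rewrite -sqnormZ /Hform /sqnorm -mulmxA [(x^T *m _) 0 0]mxE mulr_sumr -!big_split /=.
  by apply: eq_bigr => i _; rewrite !mxE; ring.
have -> : sqnorm (Hmx *m x) = 5 * sqnorm x.
  by rewrite !sqnormE trmx_mul Hmx_sym mulmxA -(mulmxA x^T) Hmx_sqr mul_mx_scalar -scalemxAl mxE.
by rewrite -e2; field.
Qed.

(** [Q] preserves norms and sends the two eigenprojections of [x] into the left and right summands,
    so they become the halves of [Q x]. *)
Lemma rotate_halves (x : 'cV[R]_8) :
  sqnorm (fst4 (Q *m x)) = (sqnorm x + Hform x / s) / 2 /\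
  sqnorm (snd4 (Q *m x)) = (sqnorm x - Hform x / s) / 2.
Proof.
have s2 : s ^+ 2 = 5 by rewrite sqr_sqrtr.
have [Hu nu] := eigenprojection x s2.
have sN2 : (- s) ^+ 2 = 5 by rewrite sqrrN.
have [Hv nv] := eigenprojection x sN2.
set u := 2^-1 *: _ in Hu nu; set v := 2^-1 *: _ in Hv nv.
have uv : x = u + v.
  rewrite /u /v invrN; move: (Hmx *m x) (s^-1) => h t.
  by apply/matrixP => i j; rewrite !mxE; field.
have Qu : snd4 (Q *m u) = 0 by have : R4_left (Q *m u) by rewrite -hU; exists u.
have Qv : fst4 (Q *m v) = 0 by have : R4_right (Q *m v) by rewrite -hV; exists v.
have z0 : sqnorm (0 : 'cV[R]_4) = 0 by rewrite /sqnorm big1 // => i _; rewrite mxE expr0n.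
have fE : fst4 (Q *m x) = fst4 (Q *m u) by rewrite uv mulmxDr fst4D Qv addr0.
have gE : snd4 (Q *m x) = snd4 (Q *m v) by rewrite uv mulmxDr snd4D Qu add0r.
rewrite fE gE; split.
  by rewrite -nu -sqnorm_rotate [RHS]sqnorm_split Qu z0 addr0.
by rewrite -mulrN -invrN -nv -sqnorm_rotate [RHS]sqnorm_split Qv z0 add0r.
Qed.

Let alpha : R := 1 + 1 / Num.sqrt 5.

(** The sign of [Hform x] tells which half is the longer one. *)
Lemma rotate_E8_large (x : 'cV[R]_8) : E8 x -> x != 0 ->
  alpha <= sqnorm (fst4 (Q *m x)) \/ alpha <= sqnorm (snd4 (Q *m x)).
Proof.
move=> Ex x0; have [-> ->] := rotate_halves x; have := E8_form_ge Ex x0.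
rewrite -/alpha -/s; have [q0|q0] := ger0P (Hform x); [left|right] => //.
by rewrite -mulNr.
Qed.

Lemma rotate_E8_min : exists x : 'cV[R]_8, [/\ E8 x, x != 0,
  sqnorm (fst4 (Q *m x)) <= alpha & sqnorm (snd4 (Q *m x)) <= alpha].
Proof.
(* The halves of this image have squared norms [1 - 1 / sqrt 5] and [alpha]. *)
pose x : 'cV[R]_8 := \col_i (i < 2)%:R.
have qx : Hform x = - 2.
  by rewrite /Hform !mxE !big_ord_recr !big_ord0 /= !mxE !big_ord_recr !big_ord0 /= !mxE /=; ring.
have nx : sqnorm x = 2 by rewrite /sqnorm !big_ord_recr big_ord0 /= !mxE /=; ring.
have s0 : 0 < s^-1 by rewrite invr_gt0 sqrtr_gt0.
exists x; have [-> ->] := rotate_halves x; rewrite qx nx; split.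
- left; split; first by move=> i; rewrite mxE natr_int.
  by exists 1; rewrite !big_ord_recr big_ord0 /= !mxE /=; ring.
- apply/eqP => /(congr1 (fun y : 'cV[R]_8 => y 0 0)) /eqP.
  by rewrite !mxE /= oner_eq0.
- by rewrite /alpha div1r -/s; lra.
- by rewrite /alpha div1r -/s; lra.
Qed.

(** * Minkowski norm of the product of balls, minimum and packing *)

Lemma enorm_le n (y : 'cV[R]_n) (t : R) : 0 <= t -> (enorm y <= t) = (sqnorm y <= t ^+ 2).
Proof.
by move=> t0; rewrite /enorm -/(sqnorm y) -[t in LHS](ger0_norm t0) -sqrtr_sqr ler_sqrt ?sqr_ge0.
Qed.

Lemma ball_productP (y : 'cV[R]_8) :
  ball_product y <-> sqnorm (fst4 y) <= 1 /\ sqnorm (snd4 y) <= 1.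
Proof. by rewrite /ball_product /euclidean_ball /= !enorm_le // expr1n. Qed.

Lemma ball_product_dilate (x : 'cV[R]_8) (t : R) : 0 < t ->
  [set t *: y | y in ball_product] x <->
  sqnorm (fst4 x) <= t ^+ 2 /\ sqnorm (snd4 x) <= t ^+ 2.
Proof.
move=> t0; have t2 : 0 < t ^+ 2 by rewrite exprn_gt0.
split=> [[y /ball_productP [y1 y2] <-]|[x1 x2]].
  by rewrite fst4Z snd4Z !sqnormZ; split; rewrite -[leRHS]mulr1 ler_pM2l.
exists (t^-1 *: x); last by rewrite scalerA divff ?scale1r // gt_eqF.
apply/ball_productP; rewrite fst4Z snd4Z !sqnormZ exprVn.
by split; rewrite mulrC ler_pdivrMr // mul1r.
Qed.

Lemma minkowski_norm_ge (x : 'cV[R]_8) (a : R) : 0 <= a ->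
  a <= sqnorm (fst4 x) \/ a <= sqnorm (snd4 x) ->
  Num.sqrt a <= minkowski_norm ball_product x.
Proof.
move=> a0 ax; apply: lb_le_inf.
  (* Some dilate must contain [x] for the infimum to inherit lower bounds; this one does, since
     [sqnorm x <= t ^+ 2]. *)
  pose t := 1 + sqnorm x.
  have x0 := sqnorm_ge0 x.
  have t0 : 0 < t by rewrite /t; lra.
  exists t; split => //; apply/ball_product_dilate => //.
  have := sqnorm_ge0 (fst4 x); have := sqnorm_ge0 (snd4 x); have := sqnorm_split x.
  by split; rewrite /t; nra.
move=> t [t0 /(ball_product_dilate _ t0) [t1 t2]].
rewrite -(ger0_norm (ltW t0)) -sqrtr_sqr ler_wsqrtr //.
by case: ax => ax; exact: (le_trans ax).
Qed.

Lemma minkowski_norm_le (x : 'cV[R]_8) (a : R) : 0 < a ->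
  sqnorm (fst4 x) <= a -> sqnorm (snd4 x) <= a ->
  minkowski_norm ball_product x <= Num.sqrt a.
Proof.
move=> a0 ax ay; apply: ge_inf; first by exists 0 => t [/ltW].
have t0 : 0 < Num.sqrt a by rewrite sqrtr_gt0.
by split => //; apply/ball_product_dilate => //; rewrite sqr_sqrtr // ltW.
Qed.

Lemma alpha_gt0 : 0 < alpha.
Proof. by rewrite /alpha ltr_pwDl // divr_ge0 // sqrtr_ge0. Qed.

Lemma rotation_unit : Q \in unitmx.
Proof. by rewrite unitmxE hQ.2 unitr1. Qed.

Lemma rotate_eq0 (x : 'cV[R]_8) : (Q *m x == 0) = (x == 0).
Proof.
apply/eqP/eqP => [Qx0|->]; last exact: mulmx0.
by rewrite -(mulKmx rotation_unit x) Qx0 mulmx0.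
Qed.

(** The value is a lower bound and is attained; a set has at most one minimum, so [xget] returns
    it. *)
Lemma min_norm_rotated_E8 : min_norm ball_product (mx_image Q E8) = Num.sqrt alpha.
Proof.
have lb y : (mx_image Q E8 `\ 0) y -> Num.sqrt alpha <= minkowski_norm ball_product y.
  case=> [[x Ex <-] /eqP]; rewrite rotate_eq0 => x0.
  by apply: minkowski_norm_ge; [exact: (ltW alpha_gt0) | exact: rotate_E8_large].
have [x [Ex x0 x1 x2]] := rotate_E8_min.
have Lx : (mx_image Q E8 `\ 0) (Q *m x).
  by split; [exists x | apply/eqP; rewrite rotate_eq0].
have xE : minkowski_norm ball_product (Q *m x) = Num.sqrt alpha.
  by apply/le_anti; rewrite lb // andbT minkowski_norm_le // alpha_gt0.
apply: xget_unique.
  by split; [exists (Q *m x) | move=> _ [y Ly <-]; exact: lb].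
move=> m [[y Ly <-] my]; apply/le_anti; rewrite lb // andbT.
by rewrite -xE; apply: my; exists (Q *m x).
Qed.

Lemma lattice_basis_rotated_E8 : lattice_basis (Q *m e8_basis R) (mx_image Q E8).
Proof. exact: lattice_basis_image rotation_unit (e8_lattice_basis R). Qed.

Lemma covol_rotated_E8 : covol (mx_image Q E8) = 1.
Proof.
by rewrite (covolE lattice_basis_rotated_E8) det_mulmx hQ.2 det_e8_basis mulr1 normr1.
Qed.

Let r : R := 2 / Num.sqrt alpha.

Lemma scale_gt0 : 0 < r.
Proof. by rewrite divr_gt0 // sqrtr_gt0 alpha_gt0. Qed.

Lemma scaled_basis : lattice_basis (r *: (Q *m e8_basis R)) (scale_set r (mx_image Q E8)).
Proof.
by apply: lattice_basis_scale lattice_basis_rotated_E8; rewrite gt_eqF // scale_gt0.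
Qed.

Lemma covol_scaled : covol (scale_set r (mx_image Q E8)) = r ^+ 8.
Proof.
rewrite (covolE scaled_basis) detZ det_mulmx hQ.2 det_e8_basis !mulr1 ger0_norm //.
by rewrite exprn_ge0 // ltW // scale_gt0.
Qed.

(** At a common interior point [p], both halves of [p - u] and [p - v] have norm below 1, so those
    of [u - v] have squared norm below 4. But [u - v] is a nonzero lattice vector, with one half of
    squared norm at least [r ^+ 2 * alpha = 4]. *)
Lemma scaled_packing : lattice_packing ball_product (scale_set r (mx_image Q E8)).
Proof.
split; first by exists (r *: (Q *m e8_basis R)); exact: scaled_basis.
move=> u v Lu Lv uv; apply/seteqP; split => // p [/interior_translate_stretch [t t1 tK]].
move=> /interior_translate_stretch [t' t1' tK'].
have {Lu Lv} [_ [x Ex <-] xE] := lattice_sub scaled_basis Lu Lv.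
have x0 : x != 0.
  apply: contra uv => /eqP x0; rewrite -subr_eq0 -xE x0 mulmx0 scaler0 //.
have inner (w : 'cV[R]_8) (c : R) : 1 < c -> ball_product (c *: w) ->
    sqnorm (fst4 w) < 1 /\ sqnorm (snd4 w) < 1.
  move=> c1 /ball_productP; rewrite fst4Z snd4Z !sqnormZ.
  have := sqnorm_ge0 (fst4 w); have := sqnorm_ge0 (snd4 w).
  by move=> ? ? [? ?]; split; nra.
have [u1 u2] := inner _ _ t1 tK; have [v1 v2] := inner _ _ t1' tK'.
have uvE : r *: (Q *m x) = (p - v) - (p - u) by rewrite xE opprB [RHS]addrC addrA subrK.
have r2 : r ^+ 2 * alpha = 4.
  rewrite /r exprMn exprVn sqr_sqrtr ?(ltW alpha_gt0) // mulfVK ?gt_eqF ?alpha_gt0 //.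
  by ring.
have fB (a b : 'cV[R]_8) : fst4 (a - b) = fst4 a - fst4 b by apply/matrixP => i j; rewrite !mxE.
have sB (a b : 'cV[R]_8) : snd4 (a - b) = snd4 a - snd4 b by apply/matrixP => i j; rewrite !mxE.
have r20 : 0 < r ^+ 2 by rewrite exprn_gt0 // scale_gt0.
have [xa|xa] := rotate_E8_large Ex x0.
  have : r ^+ 2 * alpha <= r ^+ 2 * sqnorm (fst4 (Q *m x)) by rewrite ler_pM2l.
  rewrite r2 -sqnormZ -fst4Z uvE fB.
  by have := sqnormB_le (fst4 (p - v)) (fst4 (p - u)); lra.
have : r ^+ 2 * alpha <= r ^+ 2 * sqnorm (snd4 (Q *m x)) by rewrite ler_pM2l.
rewrite r2 -sqnormZ -snd4Z uvE sB.
by have := sqnormB_le (snd4 (p - v)) (snd4 (p - u)); lra.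
Qed.

Lemma delta_rotated_E8 : delta ball_product (mx_image Q E8) = vol (@ball_product R) / 256 * alpha ^+ 4.
Proof.
rewrite /delta covol_rotated_E8 min_norm_rotated_E8 divr1 -mulrA; congr (_ * _).
rewrite expr_div_n -[8%N]/(2 * 4)%N exprM sqr_sqrtr ?(ltW alpha_gt0) // mulrC.
by congr (_^-1 * _); ring.
Qed.

(** Scaling multiplies the covolume by [r ^+ 8], and [r^-1] is half the minimum. *)
Lemma packing_density_scaled :
  packing_density ball_product (scale_set r (mx_image Q E8)) = delta ball_product (mx_image Q E8).
Proof.
rewrite /packing_density /delta covol_scaled covol_rotated_E8 min_norm_rotated_E8 divr1.
by rewrite -exprVn /r invf_div.
Qed.

End Rotation.
End GoldenSplitting.

Unset Implicit Arguments.

Theorem theorem9 (R : realType) (Q : 'M[R]_8)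
    (hQ : special_orthogonal Q)
    (hU : mx_image Q U = R4_left)
    (hV : mx_image Q V = R4_right) :
  let alpha : R := 1 + 1 / Num.sqrt 5 in
  let K : set 'cV[R]_8 := ball_product in
  let QE8 : set 'cV[R]_8 := mx_image Q E8 in
  let L : set 'cV[R]_8 := scale_set (2 / Num.sqrt alpha) QE8 in
  [/\ lattice_packing K L,
      packing_density K L = delta K QE8,
      delta K QE8 = pi ^+ 4 / 1024 * (1 + 1 / Num.sqrt 5) ^+ 4 &
      decimal_expansion_starts (delta K QE8)
        [:: 4; 1; 7; 2; 8; 2; 4; 0; 1; 4; 9; 1; 7; 1; 9]%N].
Proof.
move=> alpha K QE8 L.
have deltaE : delta K QE8 = pi ^+ 4 / 1024 * (1 + 1 / Num.sqrt 5) ^+ 4.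
  have -> := delta_rotated_E8 hQ hU hV.
  by rewrite vol_ball_product -/alpha; field.
split => //.
- exact: (scaled_packing hQ hU hV).
- exact: (packing_density_scaled hQ hU hV).
- by rewrite deltaE; exact: density_decimal.
Qed.
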